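(* Let $N\ge1$, $n,k\ge0$ and $n+k=N+1$. The minimal eigenvalue $\lambda_{\min}$ of the Laplacian $\Delta_{0,k-n}(TU_N)$ of the twisted unknot $TU_N$ in homological degree $0$ and quantum degree $k-n$ satisfies $$\lambda_{\min}\ \le\ \frac{2k(k-1)}{N+1}.$$ In particular, when $k=0$ and when $k=1$, the kernel of the Laplacian is nontrivial.
   Context: $TU_N$ is the $N$-crossing unknot diagram given by a vertical stack of $N$ identical crossings of two strands whose two top ends are joined by a cap and two bottom ends by a cup; the crossings are such that the all-0 resolution has $N+1$ circles, numbered $1,\dots,N+1$ along the stack. The Khovanov complex (without overall degree shifts) in homological degree $0$ is $V^{\otimes(N+1)}$ with $V=\mathrm{span}_{\mathbb C}\{\mathbb 1,X\}$ (orthonormal basis), where a labelling with $k$ symbols $\mathbb 1$ and $n$ symbols $X$ has quantum degree $k-n$. The Laplacian is $\Delta_0(TU_N)=\sum_{i=1}^N\mathfrak m_{i,i+1}$, where $\mathfrak m_{ij}$ acts on tensor factors $i,j$ by $\mathbb 1\mathbb 1\mapsto\mathbb 1\mathbb 1$, $\mathbb 1X\mapsto\mathbb 1X+X\mathbb 1$, $X\mathbb 1\mapsto\mathbb 1X+X\mathbb 1$, $XX\mapsto0$, and as the identity on the others. $\Delta_{0,k-n}(TU_N)$ is its restriction to the span of basis labellings with exactly $k$ symbols $\mathbb 1$ and $n$ symbols $X$. *)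

(* Defs.v *)
From HB Require Import structures.
From mathcomp Require Import all_boot all_order all_fingroup all_algebra.
From mathcomp Require Import complex reals.

Set Implicit Arguments.
Unset Strict Implicit.
Unset Printing Implicit Defensive.

Import Order.TTheory GRing.Theory Num.Theory.
Local Open Scope ring_scope.

(* A labelling of m circles by the basis of V: [true] stands for the unit of V
   and [false] for X. *)
Definition labelling (m : nat) : finType := {ffun 'I_m -> bool}.

Definition num1 (m : nat) (s : labelling m) : nat := #|[set i | s i]|.
Definition numX (m : nat) (s : labelling m) : nat := #|[set i | ~~ s i]|.

(* The m-th tensor power of V, given by coordinates in the labelling basis. *)
Definition tens (F : fieldType) (m : nat) : vectType F :=
  {ffun labelling m -> F^o}.

Definition basis_vec (F : fieldType) (m : nat) (s : labelling m) : tens F m :=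
  [ffun t => (t == s)%:R].

Definition relabel (m : nat) (s : labelling m) (i j : 'I_m) (a b : bool) :
    labelling m :=
  [ffun t => if t == i then a else if t == j then b else s t].

Definition merge_basis (F : fieldType) (m : nat) (i j : 'I_m)
    (s : labelling m) : tens F m :=
  match s i, s j with
  | true, true => basis_vec F s
  | true, false | false, true =>
      basis_vec F (relabel s i j true false)
      + basis_vec F (relabel s i j false true)
  | false, false => 0
  end.

Definition merge_fun (F : fieldType) (m : nat) (i j : 'I_m) (v : tens F m) :
    tens F m :=
  \sum_(s : labelling m) (v s : F) *: merge_basis F i j s.

Fact merge_fun_is_linear (F : fieldType) (m : nat) (i j : 'I_m) :
  linear (@merge_fun F m i j).
Proof.
move=> a u v; rewrite /merge_fun scaler_sumr -big_split /=.
by apply: eq_bigr => s _; rewrite !ffunE scalerDl scalerA.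
Qed.

HB.instance Definition _ (F : fieldType) (m : nat) (i j : 'I_m) :=
  GRing.isLinear.Build F (tens F m) (tens F m) *:%R (@merge_fun F m i j)
    (@merge_fun_is_linear F m i j).

Definition merge_op (F : fieldType) (m : nat) (i j : 'I_m) : 'End(tens F m) :=
  linfun (@merge_fun F m i j).

(* The circles are numbered from 0: the i-th crossing joins i and i + 1. *)
Definition laplacian (F : fieldType) (N : nat) : 'End(tens F N.+1) :=
  \sum_(i < N) merge_op F (widen_ord (leqnSn N) i) (lift ord0 i).

Definition degree_space (F : fieldType) (m k n : nat) : {vspace tens F m} :=
  (\sum_(s : labelling m | (num1 s == k) && (numX s == n))
     <[basis_vec F s]>)%VS.

(* For an f that maps U into itself, [vsproj U] does not alter the values of f
   on U, and this is the restriction of f to U. *)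
Definition restrict_end (F : fieldType) (vT : vectType F) (U : {vspace vT})
    (f : 'End(vT)) : 'End(subvs_of U) :=
  linfun (vsproj U \o f \o vsval).

Definition laplacian_deg (F : fieldType) (N k n : nat) :
    'End(subvs_of (degree_space F N.+1 k n)) :=
  restrict_end (degree_space F N.+1 k n) (laplacian F N).

Definition is_min_eigenvalue (C : numFieldType) (vT : vectType C)
    (f : 'End(vT)) (lam : C) : Prop :=
  passmx.leigenvalue f lam /\
  (forall mu : C, passmx.leigenvalue f mu -> lam <= mu).

Lemma merge_op_basis (F : fieldType) (m : nat) (i j : 'I_m)
  (s : labelling m) : merge_op F i j (basis_vec F s) = merge_basis F i j s.
Proof.
rewrite lfunE /= /merge_fun (bigD1 s) //= ffunE eqxx scale1r big1 ?addr0 //.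
by move=> t /negbTE nts; rewrite ffunE nts scale0r.
Qed.

Lemma basis_vec_degree (F : fieldType) (m k n : nat) (s : labelling m) :
  num1 s = k -> numX s = n -> basis_vec F s \in degree_space F m k n.
Proof.
move=> s1 sX; rewrite memvE.
by apply: (sumv_sup s); rewrite ?subvv // s1 sX !eqxx.
Qed.

Lemma num_tperm (m : nat) (i j : 'I_m) (s t : labelling m) :
  (forall x, t x = s (tperm i j x)) -> num1 t = num1 s /\ numX t = numX s.
Proof.
move=> ts; rewrite /num1 /numX; split.
  rewrite -(card_preimset [set x | s x] (@perm_inj _ (tperm i j))).
  by apply: eq_card => x; rewrite !inE ts.
rewrite -(card_preimset [set x | ~~ s x] (@perm_inj _ (tperm i j))).
by apply: eq_card => x; rewrite !inE ts.
Qed.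

Lemma merge_basis_degree (F : fieldType) (m k n : nat) (i j : 'I_m)
  (s : labelling m) :
  num1 s = k -> numX s = n -> merge_basis F i j s \in degree_space F m k n.
Proof.
move=> s1 sX; rewrite /merge_basis.
have same a b : s i = a -> s j = b -> relabel s i j a b = s.
  move=> si sj; apply/ffunP => x; rewrite ffunE.
  by case: eqP => [->//|_]; case: eqP => [->|].
have swap a b : s i = a -> s j = b -> a != b ->
    num1 (relabel s i j b a) = num1 s /\ numX (relabel s i j b a) = numX s.
  move=> si sj ab; apply: (@num_tperm _ i j) => x; rewrite ffunE.
  case: tpermP => [->|->|/eqP/negbTE -> /eqP/negbTE -> //].
    by rewrite eqxx.
  by rewrite eqxx; case: eqP => // ji; rewrite -si -sj ji eqxx in ab.
case si: (s i); case sj: (s j).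
- exact: basis_vec_degree.
- have [e1 eX] := swap _ _ si sj isT; rewrite (same _ _ si sj) memvD //.
    exact: basis_vec_degree.
  by apply: basis_vec_degree; rewrite ?e1 ?eX.
- have [e1 eX] := swap _ _ si sj isT; rewrite (same _ _ si sj) memvD //.
    by apply: basis_vec_degree; rewrite ?e1 ?eX.
  exact: basis_vec_degree.
- exact: mem0v.
Qed.

Lemma laplacian_degree (F : fieldType) (N k n : nat) (v : tens F N.+1) :
  v \in degree_space F N.+1 k n ->
  laplacian F N v \in degree_space F N.+1 k n.
Proof.
case/memv_sumP => w wv ->; rewrite linear_sum memv_suml // => s sP.
have /vlineP[a ->] := wv s sP.
rewrite linearZ memvZ //= /laplacian sum_lfunE memv_suml // => i _.
have /andP[/eqP s1 /eqP sX] := sP.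
by rewrite merge_op_basis merge_basis_degree.
Qed.

Lemma laplacian_degE (F : fieldType) (N k n : nat)
  (u : subvs_of (degree_space F N.+1 k n)) :
  vsval (laplacian_deg F N k n u) = laplacian F N (vsval u).
Proof. by rewrite lfunE /= vsprojK // laplacian_degree // subvsP. Qed.

(* Main.v *)
From HB Require Import structures.
Require Import Defs.
From mathcomp Require Import all_boot all_order all_fingroup all_algebra.
From mathcomp Require Import complex reals.

Import Order.TTheory GRing.Theory Num.Theory.
Local Open Scope ring_scope.
Local Open Scope sesquilinear_scope.

(** The bound is a Rayleigh quotient. Give each labelling with k symbols 1 and
    n symbols X the sign (-1)^p, where p is the sum of the positions of its
    symbols 1. Exchanging unequal labels at neighbouring positions flips this
    sign, so the merge at a crossing kills 1X - X1 in the signed sum, and only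
    the crossings labelled 11 survive: the Laplacian multiplies the coefficient
    of a labelling s by the number [adjacent11 s] of neighbouring pairs 11 in s
    ([laplacian_alternating]). The Rayleigh quotient of the signed sum is
    therefore the average of [adjacent11] over the labellings of the given
    degree. Since the labels 1 at two distinct positions are equally frequent
    for all choices of the two positions, this average is N times
    k (k - 1) / ((N + 1) N) ([sum_adjacent11]), that is k (k - 1) / (N + 1),
    half of the bound claimed. For k <= 1 no pair 11 exists, and the signed sum
    lies in the kernel ([laplacian_deg_alternating_eq0]).

    The labelling basis makes the restricted Laplacian a real symmetric matrix
    ([laplacian_mx_hermsym]), so the spectral theorem provides a least
    eigenvalue and bounds it by any Rayleigh quotient
    ([rayleigh_min_leigenvalue]). *)

(** * Least eigenvalue and Rayleigh quotients *)

Lemma mulmx_trmxC_diag {C : numClosedFieldType} {m : nat} (w d : 'rV[C]_m) :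
  (w *m diag_mx d *m w ^t*) 0 0 = \sum_i d 0 i * `|w 0 i| ^+ 2.
Proof.
rewrite mxE; apply: eq_bigr => i _.
by rewrite mul_mx_diag !mxE mulrAC -normCK mulrC.
Qed.

(** In a unitary eigenbasis the Rayleigh quotient of v is an average of the
    diagonal entries with nonnegative weights, hence is at least the smallest
    entry. The diagonal entries are real, so a smallest one exists although the
    order of C is only partial; and every eigenvalue is one of them. *)
Lemma rayleigh_min_eigenvalue {C : numClosedFieldType} {m : nat}
    (A : 'M[C]_m) (v : 'rV[C]_m) (q : C) :
  A \is hermsymmx -> v != 0 ->
  (v *m A *m v ^t*) 0 0 = q * (v *m v ^t*) 0 0 ->
  exists lam, [/\ eigenvalue A lam,
    forall mu, eigenvalue A mu -> lam <= mu & lam <= q].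
Proof.
move=> hA v0 vAv; set P := spectralmx A; set d := spectral_diag A.
have Pu : P \is unitarymx := spectral_unitarymx A.
have Punit : P \in unitmx := spectral_unit A.
have AE : A = invmx P *m diag_mx d *m P.
  by have /hermitian_normalmx/orthomx_spectralP := hA.
have dreal i : d 0 i \is Num.real.
  by have /mxOverP/(_ 0 i) := hermitian_spectral_diag_real hA.
have w0 (u : 'rV_m) : u != 0 -> exists i, (u *m invmx P) 0 i != 0.
  move=> u0; apply/existsP; apply: contraNT u0 => /existsPn u0.
  rewrite -[u](mulmxKV Punit); suff -> : u *m invmx P = 0 by rewrite mul0mx.
  by apply/rowP => i; have /negPn/eqP -> := u0 i; rewrite mxE.
(* A nonzero v forces the dimension to be positive, so a minimum exists. *)
have [i0 _] := w0 v v0.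
have [k _ kmin] := @real_arg_minP C 'I_m i0 predT (d 0) isT
  (fun i _ => dreal i).
exists (d 0 k); split.
- apply/eigenvalueP; exists (delta_mx 0 k *m P).
    rewrite AE !mulmxA mulmxK // scalemxAl; congr (_ *m _).
    by apply/rowP => j; rewrite mul_mx_diag !mxE eqxx mulrC;
       case: eqP => [->|]; rewrite ?mulr0.
  apply: contraTneq isT => /(congr1 (mulmx^~ (invmx P))).
  rewrite mulmxK // mul0mx => /rowP/(_ k)/eqP.
  by rewrite !mxE !eqxx oner_eq0.
- move=> mu /eigenvalueP[u uA u0]; have [i wi] := w0 u u0.
  suff -> : mu = d 0 i by apply: kmin.
  have /(congr1 (mulmx^~ (invmx P)))/rowP/(_ i) := uA.
  rewrite {1}AE !mulmxA mulmxK // mul_mx_diag -scalemxAl mxE [RHS]mxE.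
  by rewrite mulrC => /(mulIf wi).
- pose w := v *m invmx P.
  have vE : v = w *m P by rewrite /w mulmxKV.
  have wE : v ^t* = invmx P *m w ^t*.
    by rewrite {1}vE trmx_mul map_mxM invmx_unitary.
  have S0 : 0 < \sum_i `|w 0 i| ^+ 2.
    have [i wi] := w0 v v0.
    rewrite (bigD1 i) //= ltr_pwDl ?exprn_gt0 ?normr_gt0 //.
    by apply: sumr_ge0 => j _; rewrite exprn_ge0.
  have vv : (v *m v ^t*) 0 0 = \sum_i `|w 0 i| ^+ 2.
    rewrite wE {1}vE mulmxA mulmxK // mxE.
    by apply: eq_bigr => i _; rewrite !mxE -normCK.
  have vAvE : (v *m A *m v ^t*) 0 0 = \sum_i d 0 i * `|w 0 i| ^+ 2.
    by rewrite wE AE !mulmxA mulmxK // mulmx_trmxC_diag.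
  rewrite -(ler_pM2r S0) -{2}vv -vAv vAvE mulr_sumr.
  apply: ler_sum => i _; apply: ler_wpM2r; first by rewrite exprn_ge0.
  exact: kmin.
Qed.

Lemma leigenvalueP {F : fieldType} {vT : vectType F} {f : 'End(vT)} {a : F} :
  reflect (exists2 u, f u = a *: u & u != 0) (passmx.leigenvalue f a).
Proof.
have kerE u : (u \in passmx.leigenspace f a) = (f u == a *: u).
  by rewrite memv_ker !(add_lfunE, opp_lfunE, scale_lfunE, id_lfunE) subr_eq0.
apply: (iffP idP) => [f0|[u fu u0]].
  exists (vpick (passmx.leigenspace f a)); last by rewrite vpick0.
  by apply/eqP; rewrite -kerE memv_pick.
apply: contra u0 => /eqP ker0; rewrite -memv0 -ker0 kerE.
exact/eqP.
Qed.

(** A form of [rayleigh_min_eigenvalue] for an endomorphism known through a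
    coordinate system crd in which its matrix is hermitian; the inner product
    is the standard one of the coordinates. *)
Lemma rayleigh_min_leigenvalue {C : numClosedFieldType} {vT : vectType C}
    {m : nat} (f : 'End(vT)) (crd : {linear vT -> 'rV[C]_m})
    (A : 'M[C]_m) (u : vT) (q : C) :
  bijective crd -> (forall x, crd (f x) = crd x *m A) ->
  A \is hermsymmx -> u != 0 ->
  (crd (f u) *m (crd u) ^t*) 0 0 = q * (crd u *m (crd u) ^t*) 0 0 ->
  exists lam, is_min_eigenvalue f lam /\ lam <= q.
Proof.
move=> crd_bij fA hA u0; rewrite fA => uAu.
have crd0 x : (crd x == 0) = (x == 0).
  by rewrite -(inj_eq (bij_inj crd_bij) x) linear0.
have eigE a : passmx.leigenvalue f a <-> eigenvalue A a.
  split=> [/leigenvalueP[x fx x0] | /eigenvalueP[w wA w0]].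
    by apply/eigenvalueP; exists (crd x); rewrite ?crd0 // -fA fx linearZ.
  have [g _ gK] := crd_bij.
  apply/leigenvalueP; exists (g w); last by rewrite -crd0 gK.
  by apply: (bij_inj crd_bij); rewrite fA linearZ /= gK.
have := rayleigh_min_eigenvalue A (crd u) q hA.
rewrite crd0 => /(_ u0 uAu)[lam [/eigE lamA lam_min lam_q]].
by exists lam; split=> //; split=> // mu /eigE; exact: lam_min.
Qed.

(** * The Laplacian in coordinates *)

Definition swap_label {m : nat} (i j : 'I_m) (s : labelling m) : labelling m :=
  [ffun x => s (tperm i j x)].

Lemma swap_labelK {m : nat} (i j : 'I_m) : involutive (swap_label i j).
Proof. by move=> s; apply/ffunP => x; rewrite !ffunE tpermK. Qed.

Lemma relabel_id {m : nat} (i j : 'I_m) (s : labelling m) :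
  relabel s i j (s i) (s j) = s.
Proof.
by apply/ffunP => x; rewrite ffunE; case: eqP => [->|_] //; case: eqP => [->|].
Qed.

Lemma relabel_swap {m : nat} (i j : 'I_m) (s : labelling m) :
  relabel s i j (s j) (s i) = swap_label i j s.
Proof.
apply/ffunP => x; rewrite !ffunE.
case: tpermP => [->|->|/eqP/negbTE -> /eqP/negbTE -> //]; rewrite eqxx //.
by case: eqP => // ->.
Qed.

(** The three cases of the merge become one formula: identity on 11, and the
    identity plus the exchange of the two labels on 1X and X1. This form
    makes symmetry and the cancellation of signs visible. *)
Lemma merge_basisE {F : fieldType} {m : nat} (i j : 'I_m) (s : labelling m) :
  merge_basis F i j s =
  (s i && s j)%:R *: basis_vec F s
  + (s i != s j)%:R *: (basis_vec F s + basis_vec F (swap_label i j s)).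
Proof.
have := relabel_swap i j s; have := relabel_id i j s; rewrite /merge_basis.
case: (s i) (s j) => [] [] /= e1 e2;
  rewrite ?e1 ?e2 ?scale1r ?scale0r ?addr0 ?add0r //.
exact: addrC.
Qed.

Lemma merge_funE {F : fieldType} {m : nat} (i j : 'I_m) (v : tens F m)
    (t : labelling m) :
  merge_fun i j v t =
  (t i && t j)%:R * v t + (t i != t j)%:R * (v t + v (swap_label i j t)).
Proof.
have sumd (G : labelling m -> F) u : \sum_s G s * (u == s)%:R = G u.
  rewrite (bigD1 u) //= eqxx mulr1 big1 ?addr0 // => s /negbTE su.
  by rewrite eq_sym su mulr0.
have sw s : (t == swap_label i j s) = (swap_label i j t == s).
  by rewrite -(inj_eq (inv_inj (swap_labelK i j))) swap_labelK.
rewrite /merge_fun sum_ffunE.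
transitivity (\sum_s (v s * (s i && s j)%:R * (t == s)%:R
  + (v s * (s i != s j)%:R * (t == s)%:R
     + v s * (s i != s j)%:R * (swap_label i j t == s)%:R)) : F).
  apply: eq_bigr => s _; rewrite merge_basisE !ffunE sw.
  by rewrite /GRing.scale /= !mulrDr !mulrA.
rewrite !big_split /= !sumd !ffunE tpermL tpermR [t j == _]eq_sym.
by rewrite mulrDr ![_ * v _]mulrC.
Qed.

Definition crossingl {N : nat} (i : 'I_N) : 'I_N.+1 := widen_ord (leqnSn N) i.
Definition crossingr {N : nat} (i : 'I_N) : 'I_N.+1 := lift ord0 i.

Lemma crossing_neq {N : nat} (i : 'I_N) : crossingl i != crossingr i.
Proof. by rewrite -val_eqE /= /bump leq0n add1n neq_ltn ltnSn. Qed.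

Definition adjacent11 {N : nat} (s : labelling N.+1) : nat :=
  (\sum_(i < N) (s (crossingl i) && s (crossingr i)))%N.

Lemma laplacianE {F : fieldType} {N : nat} (v : tens F N.+1)
    (t : labelling N.+1) :
  laplacian F N v t =
  (adjacent11 t)%:R * v t
  + \sum_(i < N) (t (crossingl i) != t (crossingr i))%:R
      * (v t + v (swap_label (crossingl i) (crossingr i) t)).
Proof.
rewrite /laplacian sum_lfunE sum_ffunE natr_sum mulr_suml -big_split /=.
by apply: eq_bigr => i _; rewrite lfunE /= merge_funE.
Qed.

(** Exchanging two labels is an involution that preserves the condition that
    they differ, so each summand of [laplacianE] is symmetric off the
    diagonal. *)
Lemma laplacian_basis_sym {F : fieldType} {N : nat} (s t : labelling N.+1) :
  laplacian F N (basis_vec F s) t = laplacian F N (basis_vec F t) s.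
Proof.
have [->//|st] := eqVneq s t.
rewrite !laplacianE; congr (_ + _).
  by rewrite !ffunE [t == s]eq_sym (negbTE st) !mulr0.
apply: eq_bigr => i _; rewrite !ffunE [t == s]eq_sym (negbTE st) !add0r.
set a := crossingl i; set b := crossingr i.
have -> : (swap_label a b s == t) = (swap_label a b t == s).
  by rewrite -(inj_eq (inv_inj (swap_labelK a b))) swap_labelK eq_sym.
case: (swap_label a b t =P s) => [<-|_]; last by rewrite !mulr0.
by rewrite !ffunE tpermL tpermR [t b == _]eq_sym.
Qed.

Lemma laplacian_basis_real {C : numClosedFieldType} {N : nat}
    (s t : labelling N.+1) : laplacian C N (basis_vec C s) t \is Num.real.
Proof.
rewrite laplacianE !ffunE rpredD ?rpredM ?realn //.
by apply: rpred_sum => i _; rewrite ffunE rpredM ?rpredD ?realn.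
Qed.

(** * The alternating vector *)

Definition of_degree (k n : nat) {m : nat} : pred (labelling m) :=
  fun s => (num1 s == k) && (numX s == n).

Lemma of_degree_swap (k n : nat) {m : nat} (i j : 'I_m) (s : labelling m) :
  of_degree k n (swap_label i j s) = of_degree k n s.
Proof.
have [e1 eX] : num1 (swap_label i j s) = num1 s
               /\ numX (swap_label i j s) = numX s.
  by apply: (@num_tperm _ i j) => x; rewrite ffunE.
by rewrite /of_degree e1 eX.
Qed.

Definition alternating (F : fieldType) (N k n : nat) : tens F N.+1 :=
  [ffun s => if of_degree k n s
             then \prod_(x < N.+1) (-1) ^+ (s x * x) else 0].

(** Moving a symbol 1 to a neighbouring position changes the sum of the
    positions by one. *)
Lemma alternating_swap {F : fieldType} {N k n : nat} (i : 'I_N)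
    (t : labelling N.+1) :
  t (crossingl i) != t (crossingr i) ->
  alternating F N k n (swap_label (crossingl i) (crossingr i) t)
  = - alternating F N k n t.
Proof.
move=> tab; rewrite !ffunE of_degree_swap; case: ifP; rewrite ?oppr0 // => _.
have := crossing_neq i; have bumpi : bump 0 i = i.+1 by [].
move: tab; set a := crossingl i; set b := crossingr i => tab neq_ab.
rewrite (bigD1 a) //= [in RHS](bigD1 a) //=.
rewrite (bigD1 b) 1?eq_sym //= [in RHS](bigD1 b) 1?eq_sym //=.
rewrite !ffunE tpermL tpermR bumpi !mulrA -mulNr; congr (_ * _).
  move: tab; case: (t a) (t b) => [] [] // _;
  by rewrite !mul1n !mul0n exprS !expr0 ?mulr1 ?mul1r mulN1r ?opprK.
apply: eq_bigr => x /andP[xa xb].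
by rewrite ffunE tpermD // eq_sym.
Qed.

Lemma laplacian_alternating {F : fieldType} {N k n : nat}
    (t : labelling N.+1) :
  laplacian F N (alternating F N k n) t
  = (adjacent11 t)%:R * alternating F N k n t.
Proof.
rewrite laplacianE big1 ?addr0 // => i _.
case: eqVneq => [_|tab]; first by rewrite mul0r.
by rewrite alternating_swap // subrr mulr0.
Qed.

Lemma norm_alternating {C : numClosedFieldType} {N k n : nat}
    (t : labelling N.+1) :
  of_degree k n t -> `|alternating C N k n t| = 1.
Proof.
move=> td; rewrite ffunE td normr_prod big1 // => x _.
by rewrite normrX normrN1 expr1n.
Qed.

(** * Counting labellings *)

Definition pairs11 (k n : nat) {m : nat} (a b : 'I_m) : nat :=
  (\sum_(s : labelling m | of_degree k n s) (s a && s b))%N.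

Lemma pairs11_tperm (k n : nat) {m : nat} (i j a b : 'I_m) :
  pairs11 k n (tperm i j a) (tperm i j b) = pairs11 k n a b.
Proof.
rewrite /pairs11 [RHS](reindex_inj (inv_inj (swap_labelK i j))) /=.
by apply: eq_big => s *; rewrite ?of_degree_swap ?ffunE.
Qed.

(** Permuting positions preserves the degree, and permutations act transitively
    on ordered pairs of distinct positions: one transposition brings a to c, a
    second one, which fixes c, brings the image of b to d. *)
Lemma pairs11_const (k n : nat) {m : nat} (a b c d : 'I_m) :
  a != b -> c != d -> pairs11 k n a b = pairs11 k n c d.
Proof.
move=> ab cd; rewrite -(pairs11_tperm k n a c a b) tpermL.
have cb : c != tperm a c b by rewrite -{1}(tpermL a c) (inj_eq perm_inj).
by rewrite -(pairs11_tperm k n (tperm a c b) d c) tpermL tpermD // eq_sym.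
Qed.

Lemma num1E {m : nat} (s : labelling m) : num1 s = (\sum_(x < m) s x)%N.
Proof.
by rewrite /num1 -sum1_card big_mkcond /=; apply: eq_bigr => x _;
   rewrite inE; case: (s x).
Qed.

(** Double counting: each labelling with k symbols 1 has k (k - 1) ordered pairs
    of distinct positions carrying them. *)
Lemma sum_pairs11 (k n : nat) {m : nat} :
  (\sum_(a < m) \sum_(b < m | b != a) pairs11 k n a b
   = k * k.-1 * #|@of_degree k n m|)%N.
Proof.
rewrite /pairs11; under eq_bigr do rewrite exchange_big /=.
rewrite exchange_big /= mulnC -sum_nat_const.
apply: eq_big => [s|s /andP[/eqP s1 _]]; first by [].
rewrite -{1}s1 num1E big_distrl /=; apply: eq_bigr => a _.
case sa: (s a); last by rewrite big1.
have := num1E s; rewrite s1 (bigD1 a) //= sa add1n => ->.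
by rewrite mul1n.
Qed.

(** Of the (N + 1) N ordered pairs of distinct positions, all equally frequent
    by [pairs11_const], exactly N are crossings. The identity is stated without
    division, which also covers N = 0. *)
Lemma sum_adjacent11 (k n : nat) {N : nat} :
  (N.+1 * \sum_(s : labelling N.+1 | of_degree k n s) adjacent11 s
   = k * k.-1 * #|@of_degree k n N.+1|)%N.
Proof.
rewrite -sum_pairs11 /adjacent11 exchange_big /=.
case: N => [|N].
  rewrite big_ord0 muln0 big1 // => a _.
  by rewrite big_pred0 // => b; rewrite !ord1 eqxx.
pose B := @pairs11 k n N.+2 ord0 ord_max.
have pE a b : a != b -> @pairs11 k n N.+2 a b = B.
  by move=> ab; apply: pairs11_const.
rewrite (eq_bigr (fun=> B)) => [|i _]; last exact/pE/crossing_neq.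
rewrite [RHS](eq_bigr (fun=> N.+1 * B)%N) => [|a _]; last first.
  rewrite (eq_bigr (fun=> B)) => [|b ba]; last by rewrite pE // eq_sym.
  by rewrite sum_nat_const cardC1 card_ord.
by rewrite !sum_nat_const !card_ord.
Qed.

Lemma adjacent11_eq0 {N : nat} (s : labelling N.+1) :
  (num1 s <= 1)%N -> adjacent11 s = 0%N.
Proof.
move=> s1; apply: big1 => i _; apply/eqP; rewrite eqb0.
apply: contraL s1 => /andP[sl sr]; rewrite -ltnNge num1E.
rewrite (bigD1 (crossingl i)) //= (bigD1 (crossingr i)) /=; last first.
  by rewrite eq_sym crossing_neq.
by rewrite sl sr.
Qed.

Lemma of_degree_inhabited {k n m : nat} : (n + k)%N = m ->
  exists s : labelling m, of_degree k n s.
Proof.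
move=> nkm; pose r := take k (enum 'I_m).
have num1X (s : labelling m) : (num1 s + numX s)%N = m.
  rewrite -[RHS](card_ord m) -(cardsC [set i | s i]); congr (_ + _)%N.
  by apply: eq_card => x; rewrite !inE.
exists [ffun x => x \in r]; rewrite /of_degree.
have s1 : num1 [ffun x => x \in r] = k.
  transitivity #|r|; first by apply: eq_card => x; rewrite inE ffunE.
  rewrite (card_uniqP _) ?take_uniq ?enum_uniq // size_takel //.
  by rewrite size_enum_ord -nkm leq_addl.
by rewrite s1 eqxx -(eqn_add2l k) -{1}s1 num1X -nkm addnC eqxx.
Qed.

(** * Coordinates on the space of a given degree *)

Lemma mem_degree_spaceP {F : fieldType} {m k n : nat} {v : tens F m} :
  reflect (forall s, ~~ of_degree k n s -> v s = 0)
    (v \in degree_space F m k n).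
Proof.
apply: (iffP idP) => [/memv_sumP[w wv ->] s sd | v0].
  rewrite sum_ffunE big1 // => t td.
  have /vlineP[a ->] := wv t td.
  rewrite !ffunE; case: eqP => [st|_]; last by rewrite scaler0.
  by rewrite st /of_degree td in sd.
have -> : v = \sum_s (v s : F) *: basis_vec F s.
  apply/ffunP => t; rewrite sum_ffunE (bigD1 t) //= !ffunE eqxx.
  rewrite big1 => [|s /negbTE st]; first by rewrite addr0 /GRing.scale /= mulr1.
  by rewrite !ffunE eq_sym st scaler0.
apply: memv_suml => s _.
have [/andP[/eqP s1 /eqP sX]|sd] := boolP (of_degree k n s).
  by rewrite memvZ // basis_vec_degree.
by rewrite v0 // scale0r mem0v.
Qed.

Definition degree_coords {F : fieldType} (m k n : nat)
    (u : subvs_of (degree_space F m k n)) :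
    'rV[F]_#|@of_degree k n m| :=
  \row_j vsval u (enum_val j).

Fact degree_coords_is_linear {F : fieldType} (m k n : nat) :
  linear (@degree_coords F m k n).
Proof. by move=> a u v; apply/rowP => j; rewrite !mxE linearP !ffunE. Qed.

HB.instance Definition _ (F : fieldType) (m k n : nat) :=
  GRing.isLinear.Build F _ _ *:%R (@degree_coords F m k n)
    (@degree_coords_is_linear F m k n).

Lemma degree_coords_bij {F : fieldType} (m k n : nat) :
  bijective (@degree_coords F m k n).
Proof.
pose T := of_degree k n : pred (labelling m).
pose U := degree_space F m k n.
pose g (w : 'rV[F]_#|T|) : subvs_of U :=
  vsproj U (\sum_j w 0 j *: basis_vec F (enum_val j)).
have gE w : vsval (g w) = \sum_j w 0 j *: basis_vec F (enum_val j).
  rewrite vsprojK // memv_suml // => j _; rewrite memvZ //.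
  by have /andP[/eqP s1 /eqP sX] := enum_valP j; apply: basis_vec_degree.
have coordsK w : degree_coords m k n (g w) = w.
  apply/rowP => j; rewrite mxE gE sum_ffunE (bigD1 j) //= !ffunE eqxx.
  rewrite big1 => [|i /negbTE ij]; first by rewrite addr0 /GRing.scale /= mulr1.
  by rewrite !ffunE (inj_eq enum_val_inj) eq_sym ij scaler0.
have coords_inj : injective (@degree_coords F m k n).
  move=> u v uv; apply/val_inj/ffunP => s.
  have [sT|sT] := boolP (s \in T).
    by have /rowP/(_ (enum_rank_in sT s)) := uv; rewrite !mxE enum_rankK_in.
  by rewrite !(mem_degree_spaceP (subvsP _)).
by exists g => // u; apply: coords_inj; rewrite coordsK.
Qed.

Definition laplacian_mx (F : fieldType) (N k n : nat) :
    'M[F]_#|@of_degree k n N.+1| :=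
  \matrix_(i, j) laplacian F N (basis_vec F (enum_val i)) (enum_val j).

Lemma degree_coords_laplacian {F : fieldType} {N k n : nat}
    (u : subvs_of (degree_space F N.+1 k n)) :
  degree_coords _ _ _ (laplacian_deg F N k n u)
  = degree_coords _ _ _ u *m laplacian_mx F N k n.
Proof.
have uE : vsval u =
    \sum_(j < #|@of_degree k n N.+1|)
      degree_coords _ _ _ u 0 j *: basis_vec F (enum_val j).
  apply/ffunP => t; rewrite sum_ffunE.
  have [tT|tT] := boolP (of_degree k n t); last first.
    rewrite (mem_degree_spaceP (subvsP u)) // big1 // => j _.
    rewrite !ffunE; case: eqP => [tj|_]; last by rewrite scaler0.
    by case/negP: tT; rewrite tj; exact: (enum_valP j).
  pose j := enum_rank_in (tT : t \in of_degree k n) t.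
  have jt : enum_val j = t by rewrite enum_rankK_in.
  rewrite (bigD1 j) //= big1 => [|i /negbTE ij].
    by rewrite !ffunE mxE jt eqxx addr0 /GRing.scale /= mulr1.
  by rewrite !ffunE -jt (inj_eq enum_val_inj) eq_sym ij scaler0.
apply/rowP => i; rewrite !mxE laplacian_degE {1}uE linear_sum sum_ffunE.
by apply: eq_bigr => j _; rewrite linearZ !ffunE !mxE.
Qed.

Lemma laplacian_mx_hermsym {C : numClosedFieldType} (N k n : nat) :
  laplacian_mx C N k n \is hermsymmx.
Proof.
apply/is_hermitianmxP; rewrite expr0 scale1r; apply/matrixP => i j.
by rewrite !mxE laplacian_basis_sym conj_Creal // laplacian_basis_real.
Qed.

(** * The minimal eigenvalue *)

Lemma alternating_mem {F : fieldType} (N k n : nat) :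
  alternating F N k n \in degree_space F N.+1 k n.
Proof. by apply/mem_degree_spaceP => s /negbTE sd; rewrite ffunE sd. Qed.

Definition alternating_deg (F : fieldType) (N k n : nat) :
    subvs_of (degree_space F N.+1 k n) :=
  vsproj (degree_space F N.+1 k n) (alternating F N k n).

Lemma alternating_degE {F : fieldType} (N k n : nat) :
  vsval (alternating_deg F N k n) = alternating F N k n.
Proof. by rewrite vsprojK // alternating_mem. Qed.

Lemma alternating_deg_neq0 {C : numClosedFieldType} {N k n : nat} :
  (n + k)%N = N.+1 -> alternating_deg C N k n != 0.
Proof.
move=> nk; have [s sd] := of_degree_inhabited nk.
apply: contraTneq isT => u0; have := @norm_alternating C _ _ _ _ sd.
by rewrite -alternating_degE u0 ffunE normr0 => /eqP; rewrite eq_sym oner_eq0.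
Qed.

(** The signs have modulus one, so the squared norm of the alternating vector is
    the number of labellings of the degree, and its energy is the sum of
    [adjacent11] over them. *)
Lemma laplacian_deg_min_eigenvalue {C : numClosedFieldType} {N k n : nat} :
  (n + k)%N = N.+1 ->
  exists lam, is_min_eigenvalue (laplacian_deg C N k n) lam
    /\ lam <= k%:R * (k%:R - 1) / N.+1%:R.
Proof.
move=> nk; pose u := alternating_deg C N k n.
apply: (rayleigh_min_leigenvalue _ (degree_coords _ _ _)
          (laplacian_mx C N k n) u).
- exact: degree_coords_bij.
- exact: degree_coords_laplacian.
- exact: laplacian_mx_hermsym.
- exact: alternating_deg_neq0.
have normT (j : 'I_#|@of_degree k n N.+1|) :
    alternating C N k n (enum_val j) * (alternating C N k n (enum_val j))^* = 1.
  by rewrite -normCK norm_alternating ?expr1n //; exact: (enum_valP j).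
have -> : (degree_coords _ _ _ u *m (degree_coords _ _ _ u) ^t*) 0 0
    = #|@of_degree k n N.+1|%:R :> C.
  rewrite mxE (eq_bigr (fun=> 1)) => [|j _].
    by rewrite sumr_const card_ord.
  by rewrite !mxE alternating_degE normT.
have -> : (degree_coords _ _ _ (laplacian_deg C N k n u)
           *m (degree_coords _ _ _ u) ^t*) 0 0
    = (\sum_(s : labelling N.+1 | of_degree k n s) adjacent11 s)%N%:R :> C.
  rewrite mxE natr_sum [RHS]big_enum_val /=; apply: eq_bigr => j _.
  rewrite !mxE laplacian_degE alternating_degE laplacian_alternating.
  by rewrite -mulrA normT mulr1.
have := congr1 (fun x => x%:R : C) (@sum_adjacent11 k n N).
have -> : k%:R * (k%:R - 1) = (k * k.-1)%:R :> C.
  case: (k) => [|k']; first by rewrite mul0r.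
  by rewrite natrM -[in _ - 1]natr1 addrK.
rewrite natrM [in RHS]natrM => sumE; rewrite mulrAC -sumE mulrC mulKf //.
by rewrite pnatr_eq0.
Qed.

Lemma laplacian_deg_alternating_eq0 {F : fieldType} {N k n : nat} :
  (k <= 1)%N -> laplacian_deg F N k n (alternating_deg F N k n) = 0.
Proof.
move=> k1; apply/val_inj/ffunP => t.
rewrite /= laplacian_degE alternating_degE laplacian_alternating !ffunE.
case: ifP => [/andP[/eqP t1 _]|_]; last by rewrite mulr0.
by rewrite adjacent11_eq0 ?mul0r // t1.
Qed.

Theorem corollary37 (R : realType) (N n k : nat) (hN : (1 <= N)%N)
    (hnk : (n + k)%N = N.+1) :
  (exists lam : R[i],
     is_min_eigenvalue (laplacian_deg R[i] N k n) lam /\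
     lam <= 2%:R * k%:R * (k%:R - 1) / N.+1%:R) /\
  (k = 0%N \/ k = 1%N -> lker (laplacian_deg R[i] N k n) != 0%VS).
Proof.
split=> [|k01].
  have [lam [lam_min lam_le]] := @laplacian_deg_min_eigenvalue R[i] _ _ _ hnk.
  exists lam; split=> //; apply: le_trans lam_le _.
  (* The claimed bound is twice the one found, which is nonnegative. *)
  rewrite -!mulrA [leRHS]mulr_natl mulr2n lerDl mulrA.
  case: k {lam_min hnk} => [|k]; first by rewrite !mul0r.
  by rewrite divr_ge0 ?mulr_ge0 ?ler0n // subr_ge0 ler1n.
have k1 : (k <= 1)%N by case: k01 => ->.
apply: contraTneq (@alternating_deg_neq0 R[i] _ _ _ hnk) => ker0.
rewrite negbK -memv0 -ker0 memv_ker.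
by rewrite laplacian_deg_alternating_eq0.
Qed.
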